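(* Let $G$ be a graph of order $n>4$ such that $\eta(H)+\eta(\overline{H})\leq \eta(G)+\eta(\overline{G})$ for all graphs $H$ of order $n$. Then: 1) $G$ and $\overline{G}$ are both connected; 2) $G$ and $\overline{G}$ both have diameter $2$ or $3$; 3) neither $G$ nor $\overline{G}$ has a pendent vertex (vertex of degree $1$) or a cut vertex.
   Context: Graphs are finite, simple, undirected. $\overline{G}$ is the complement of $G$. $\eta(G)$ is the number of nonempty vertex subsets $S\subseteq V(G)$ such that the induced subgraph on $S$ is connected. A cut vertex is a vertex whose deletion increases the number of connected components. The diameter is the maximum distance between two vertices. *)

(* Defs.v *)
From mathcomp Require Import all_boot.

Set Implicit Arguments.
Unset Strict Implicit.
Unset Printing Implicit Defensive.

Record graph := Graph {
  vertex :> finType;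
  adj : rel vertex;
  adj_sym : symmetric adj;
  adj_irr : irreflexive adj }.

Section Complement.
Variable G : graph.

Definition compl_adj : rel G := [rel x y | (x != y) && ~~ adj x y].

Lemma compl_adj_sym : symmetric compl_adj.
Proof. by move=> x y; rewrite /compl_adj /= eq_sym adj_sym. Qed.

Lemma compl_adj_irr : irreflexive compl_adj.
Proof. by move=> x; rewrite /compl_adj /= eqxx. Qed.

Definition complement : graph := Graph compl_adj_sym compl_adj_irr.
End Complement.

Section Induced.
Variables (G : graph) (S : {set G}).

Definition induced_adj : rel {x : G | x \in S} :=
  [rel u v | adj (val u) (val v)].

Lemma induced_adj_sym : symmetric induced_adj.
Proof. by move=> u v; rewrite /induced_adj /= adj_sym. Qed.

Lemma induced_adj_irr : irreflexive induced_adj.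
Proof. by move=> u; rewrite /induced_adj /= adj_irr. Qed.

Definition induced : graph := Graph induced_adj_sym induced_adj_irr.
End Induced.

Definition connected (G : graph) : bool :=
  [forall x : G, forall y : G, connect (@adj G) x y].

Definition num_components (G : graph) : nat := n_comp (@adj G) G.

Definition eta (G : graph) : nat :=
  #|[set S : {set G} | (S != set0) && connected (induced S)]|.

Definition degree (G : graph) (x : G) : nat := #|[set y | adj x y]|.

Definition pendent (G : graph) (x : G) : bool := degree x == 1.

Definition cut_vertex (G : graph) (x : G) : bool :=
  num_components G < num_components (induced [set~ x]).

Definition has_walk (G : graph) (x y : G) (k : nat) : bool :=
  [exists p : k.-tuple G, path (@adj G) x p && (last x p == y)].

(* The least length of a walk from x to y. A shortest walk has fewer than
   #|G| edges, so the search range is exhaustive; if no walk exists, [find]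
   returns #|G|, which exceeds every finite distance and stands for infinity. *)
Definition dist (G : graph) (x y : G) : nat :=
  find (has_walk x y) (iota 0 #|G|).

Definition diameter (G : graph) : nat :=
  \max_(x : G) \max_(y : G) dist x y.

(* Main.v *)
Require Import Defs.
From mathcomp Require Import all_boot.

(* Every vertex set induces a connected subgraph of G or of its complement, so
   eta G + eta (complement G) = 2^n - 1 + b(G), where b(G) counts the nonempty
   sets that are connected in both. It remains to study the graphs maximizing
   b; their class is closed under complementation.
   - If G is disconnected and has an induced path a-b-c, joining a to a vertex
     of another component destroys no such set and creates an induced P4;
     without an induced P3 only the singletons count.
   - If d(u, v) >= 4, adding the edge uv destroys no such set, since every set
     connected in G and containing u and v has a vertex adjacent to neither,
     and it creates an induced P4.
   - If x is a cut vertex, let C be a component of G - x containing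
     non-neighbours of x, A the neighbours and B the non-neighbours of x in C,
     and D the rest of G - x. Adding suitable edges between C and D shows first
     that D is complete to x, then that every vertex of A has a neighbour in B,
     and finally that A is complete to B. Hence G is a blow-up of the path
     D-x-A-B; as n > 4, some part contains two vertices, and reattaching one of
     them so that it becomes a fifth part closing the path to a blow-up of C5
     increases b.
   A pendent vertex makes its neighbour a cut vertex. *)

Set Implicit Arguments.
Unset Strict Implicit.
Unset Printing Implicit Defensive.

(** * Sets connected both in a graph and in its complement *)

Section Relations.
Variable V : finType.
Implicit Types (e : rel V) (S T X : {set V}) (y z u v a b c d : V).

(** Kept on [V] instead of a subtype, so that walks in different sets and for different relations
    can be compared; a vertex outside [S] reaches only itself. *)
Definition restr e S : rel V := [rel y z | [&& y \in S, z \in S & e y z]].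

Definition conn e S : bool :=
  [forall y in S, forall z in S, connect (restr e S) y z].

Definition co e : rel V := [rel y z | (y != z) && ~~ e y z].

Definition bic e : {set {set V}} :=
  [set S | [&& S != set0, conn e S & conn (co e) S]].

Definition bic_max e := forall e', symmetric e' -> irreflexive e' ->
  #|bic e'| <= #|bic e|.

Definition adde e u v : rel V :=
  [rel y z | [|| e y z, (y == u) && (z == v) | (y == v) && (z == u)]].

Lemma connP e S :
  reflect {in S &, forall y z, connect (restr e S) y z} (conn e S).
Proof.
apply: (iffP 'forall_in_'forall_in_idP); first by move=> h y z yS zS; apply: h.
by move=> h y yS z zS; apply: h.
Qed.

Lemma co_sym e : symmetric e -> symmetric (co e).
Proof. by move=> es y z; rewrite /co /= eq_sym es. Qed.

Lemma co_irr e : irreflexive (co e).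
Proof. by move=> y; rewrite /co /= eqxx. Qed.

Lemma restr_sym e S : symmetric e -> symmetric (restr e S).
Proof. by move=> es y z; rewrite /restr /= es andbCA. Qed.

Lemma connectC e S y z : symmetric e ->
  connect (restr e S) y z = connect (restr e S) z y.
Proof. by move=> es; apply/sym_connect_sym/restr_sym. Qed.

Lemma adde_sym e u v : symmetric e -> symmetric (adde e u v).
Proof.
by move=> es y z; rewrite /adde /= es; congr orb; rewrite orbC; congr orb; apply: andbC.
Qed.

Lemma adde_irr e u v : irreflexive e -> u != v -> irreflexive (adde e u v).
Proof.
move=> ei uv y; rewrite /adde /= ei /= [X in _ || X]andbC orbb.
by apply/negP => /andP[/eqP-> /eqP h]; rewrite h eqxx in uv.
Qed.

Lemma connect_cut (r : rel V) X y z :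
  connect r y z -> y \in X -> z \notin X ->
  exists p q, [/\ p \in X, q \notin X & r p q].
Proof.
case/connectP=> s; elim: s y => [|w s IH] y /=.
  by move=> _ -> ->.
case/andP=> yw ws zl yX zX; case: (boolP (w \in X)) => wX; first exact: IH wX zX.
by exists y, w.
Qed.

Lemma conn_cut e S X y z : conn e S -> y \in S -> z \in S -> y \in X ->
  z \notin X ->
  exists p q, [/\ p \in S, q \in S, p \in X, q \notin X & e p q].
Proof.
move=> /connP h yS zS yX zX.
have [p [q [pX qX /and3P[pS qS pq]]]] := connect_cut (h _ _ yS zS) yX zX.
by exists p, q.
Qed.

Lemma conn_hub e S r : symmetric e ->
  (forall y, y \in S -> connect (restr e S) y r) -> conn e S.
Proof.
move=> es h; apply/connP=> y z yS zS; apply: connect_trans (h _ yS) _.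
by rewrite connectC //; apply: h.
Qed.

Lemma conn_sub e e' S :
  {in S &, forall y z, e y z -> connect (restr e' S) y z} ->
  conn e S -> conn e' S.
Proof.
move=> sub /connP h; apply/connP=> y z yS zS.
apply: connect_sub (h y z yS zS) => p q /and3P[pS qS pq]; exact: sub.
Qed.

Lemma restr1 e S y z : y \in S -> z \in S -> e y z -> connect (restr e S) y z.
Proof. by move=> yS zS yz; apply: connect1; rewrite /restr /= yS zS yz. Qed.

Lemma conn1 e y : conn e [set y].
Proof. by apply/connP=> a b /set1P-> /set1P->; apply: connect0. Qed.

Lemma bic1 e y : [set y] \in bic e.
Proof. by rewrite inE -card_gt0 cards1 !conn1. Qed.

(** All pairs between the component of [y] in [e] and the rest of [S] are joined in [co e]. If some
    [z] lies outside that component, then [y] reaches the outside directly and its own component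
    through [z]. *)
Lemma conn_or e S : symmetric e -> conn e S || conn (co e) S.
Proof.
move=> es; case: (boolP (conn e S)) => //= nc.
move: nc; rewrite /conn negb_forall_in => /exists_inP[y yS].
rewrite negb_forall_in => /exists_inP[z zS nyz].
pose K := connect (restr e S) y.
have cross p q : p \in S -> q \in S -> K p -> ~~ K q -> co e p q.
  move=> pS qS Kp Kq; rewrite /co /=; apply/andP; split.
    by apply: contraNneq Kq => <-.
  by apply: contra Kq => pq; apply: connect_trans Kp (restr1 pS qS pq).
have Ky : K y by apply: connect0.
have ces := co_sym es.
apply: (@conn_hub _ _ y) => // p pS; rewrite connectC //.
case: (boolP (K p)) => Kp; last exact: restr1 (cross _ _ _ _ _ _).
apply: connect_trans (restr1 yS zS (cross _ _ yS zS Ky nyz)) _.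
by rewrite connectC //; apply: restr1 => //; apply: cross.
Qed.

Lemma conn_path4 e a b c d : symmetric e -> e a b -> e b c -> e c d ->
  conn e [set a; b; c; d].
Proof.
move=> es ab bc cd; apply: (@conn_hub _ _ b) => // y yS.
have [aS bS cS dS] : [/\ a \in [set a; b; c; d], b \in [set a; b; c; d],
    c \in [set a; b; c; d] & d \in [set a; b; c; d]].
  by rewrite !inE !eqxx !orbT.
have cb : connect (restr e [set a; b; c; d]) c b by apply: restr1; rewrite // es.
move: yS; rewrite !inE -!orbA => /or4P[] /eqP ->.
- exact: restr1.
- exact: connect0.
- exact: cb.
- by apply: connect_trans cb; apply: restr1; rewrite // es.
Qed.

(** The complement of the path a-b-c-d is the path b-d-a-c. *)
Lemma bic_path4 e a b c d : symmetric e -> irreflexive e ->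
  e a b -> e b c -> e c d -> ~~ e a c -> ~~ e a d -> ~~ e b d ->
  [set a; b; c; d] \in bic e.
Proof.
move=> es ei ab bc cd ac ad bd; rewrite inE conn_path4 // andTb.
apply/andP; split; first by apply/set0Pn; exists a; rewrite !inE eqxx.
have -> : [set a; b; c; d] = [set b; d; a; c].
  by apply/setP => y; rewrite !inE; do !case: eqP.
apply: conn_path4; rewrite /co /=; first exact: co_sym.
- by rewrite bd andbT; apply: contraNneq ad => <-.
- by rewrite es ad andbT; apply: contraNneq ac => <-; rewrite es.
- by rewrite ac andbT; apply: contraNneq ad => ->.
Qed.

Lemma nbic_cut e S X y z : y \in S -> z \in S -> y \in X -> z \notin X ->
  {in S &, forall p q, p \in X -> q \notin X -> ~~ e p q} -> S \notin bic e.
Proof.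
move=> yS zS yX zX h; rewrite inE; apply/negP => /and3P[_ ce _].
have [p [q [pS qS pX qX]]] := conn_cut ce yS zS yX zX.
by apply/negP; apply: h.
Qed.

Lemma nbic_cocut e S X y z : y \in S -> z \in S -> y \in X -> z \notin X ->
  {in S &, forall p q, p \in X -> q \notin X -> e p q} -> S \notin bic e.
Proof.
move=> yS zS yX zX h; rewrite inE; apply/negP => /and3P[_ _ ce].
have [p [q [pS qS pX qX /andP[_ /negP]]]] := conn_cut ce yS zS yX zX.
by apply; apply: h.
Qed.

Lemma nbic_isolated e S y z : y \in S -> z \in S -> y != z ->
  {in S, forall w, ~~ e y w} -> S \notin bic e.
Proof.
move=> yS zS yz h; apply: (nbic_cut yS zS (set11 y)); first by rewrite inE eq_sym.
by move=> p q _ qS /set1P-> _; apply: h.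
Qed.

Lemma nbic_dominating e S y z : y \in S -> z \in S -> y != z ->
  {in S, forall w, w != y -> e y w} -> S \notin bic e.
Proof.
move=> yS zS yz h; apply: (nbic_cocut yS zS (set11 y)); first by rewrite inE eq_sym.
by move=> p q _ qS /set1P->; rewrite inE; apply: h.
Qed.

(** The new edge cannot disconnect [S] in the graph, and in the complement it removes only the step
    between [u] and [v], so one detour for that step is enough. *)
Lemma bic_adde e u v S : symmetric e -> S \in bic e ->
  (u \in S -> v \in S -> connect (restr (co (adde e u v)) S) u v) ->
  S \in bic (adde e u v).
Proof.
move=> es; rewrite !inE => /and3P[-> ce cc] h /=; apply/andP; split.
  by apply: conn_sub ce => y z yS zS yz; apply: restr1; rewrite /adde /= ?yz.
apply: conn_sub cc => y z yS zS /andP[yz nyz].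
case: (boolP (adde e u v y z)) => [|n]; last first.
  by apply: restr1; rewrite // /co /= yz.
rewrite /adde /= (negbTE nyz) /= => /orP[] /andP[/eqP ? /eqP ?]; subst.
  exact: h.
by rewrite connectC; [exact: h|apply/co_sym/adde_sym].
Qed.

Lemma co_adde e u v y z : y != z -> ~~ e y z ->
  ((y == u) && (z == v) = false) -> ((y == v) && (z == u) = false) ->
  co (adde e u v) y z.
Proof. by move=> yz nyz h1 h2; rewrite /co /adde /= yz (negbTE nyz) h1 h2. Qed.

Lemma bic_max_gain_loss e e' : bic_max e -> symmetric e' -> irreflexive e' ->
  #|bic e' :\: bic e| <= #|bic e :\: bic e'|.
Proof.
move=> m s i; have := m _ s i.
by rewrite -(cardsID (bic e) (bic e')) -(cardsID (bic e') (bic e)) setIC leq_add2l.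
Qed.

Lemma bic_max_no_loss e e' : bic_max e -> symmetric e' -> irreflexive e' ->
  bic e \subset bic e' -> bic e' \subset bic e.
Proof.
move=> m s i; rewrite -!setD_eq0 -!cards_eq0 => /eqP h.
by have := bic_max_gain_loss m s i; rewrite h leqn0.
Qed.

(** Used by contradiction: once every counted set has a detour, a single set created by the edge
    refutes maximality. *)
Lemma bic_max_adde e u v S : symmetric e -> irreflexive e -> bic_max e -> u != v ->
  (forall T, T \in bic e -> u \in T -> v \in T ->
     connect (restr (co (adde e u v)) T) u v) ->
  S \in bic (adde e u v) -> S \in bic e.
Proof.
move=> es ei m uv h; apply/subsetP; apply: bic_max_no_loss => //.
- exact: adde_sym.
- exact: adde_irr.
- by apply/subsetP => T bT; apply: bic_adde => //; apply: h.
Qed.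

(** * Connectedness and distances in a maximizer *)

Lemma bic_max_conn e : symmetric e -> irreflexive e -> 3 < #|V| -> bic_max e ->
  conn e setT.
Proof.
move=> es ei V3 m; apply: contraT => nc.
case: (boolP [exists a, exists b, exists c,
    [&& e a b, e b c, a != c & ~~ e a c]]).
  case/existsP=> a /existsP[b /existsP[c /and4P[ab bc ac nac]]].
  have [y nya] : exists y, ~~ connect (restr e setT) y a.
    apply/existsP; move: nc; apply: contraR.
    rewrite negb_exists => /forallP h; apply: (@conn_hub _ _ a) => // y _.
    by have := h y; rewrite negbK.
  have cab : connect (restr e setT) b a by apply: restr1; rewrite ?inE // es.
  have cac : connect (restr e setT) c a.
    by apply: connect_trans cab; apply: restr1; rewrite ?inE // es.
  have far w : connect (restr e setT) w a -> (y != w) /\ ~~ e y w.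
    move=> wa; split; first by apply: contraNneq nya => ->.
    by apply: contra nya => yw; apply: connect_trans wa; apply: restr1; rewrite ?inE.
  have [ya nya1] := far a (connect0 _ _).
  have [yb nyb] := far b cab.
  have [yc nyc] := far c cac.
  have ba : b != a by apply: contraTneq ab => ->; rewrite ei.
  have S4 : [set y; a; b; c] \in bic (adde e y a).
    apply: bic_path4; rewrite /adde /= ?ab ?bc ?eqxx ?orbT //.
    - exact: adde_sym.
    - exact: adde_irr.
    - by rewrite (negbTE nyb) (negbTE ba) (negbTE ya).
    - by rewrite (negbTE nyc) [c == a]eq_sym (negbTE ac) (negbTE ya).
    - by rewrite (negbTE nac) eq_sym (negbTE ya) /= [c == y]eq_sym (negbTE yc).
  suff : [set y; a; b; c] \in bic e.
    apply: contraTT => _; apply: (@nbic_isolated _ _ y a) => //; rewrite ?inE ?eqxx ?orbT //.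
    by move=> w; rewrite !inE -!orbA => /or4P[] /eqP-> //; rewrite ei.
  (* No set is lost: [y] and [a] lie in different components of [e], so no connected set contains
     both. *)
  apply: bic_max_adde (ya) _ (S4) => // T; rewrite inE => /and3P[_ /connP cT _] yT aT.
  case/negP: nya; apply: connect_sub (cT _ _ yT aT) => p q /and3P[_ _ pq].
  by apply: restr1; rewrite ?inE.
move=> noP3.
have tr a b c : e a b -> e b c -> a != c -> e a c.
  move=> ab bc ac; apply: contraR noP3 => nac.
  by apply/existsP; exists a; apply/existsP; exists b; apply/existsP; exists c; apply/and4P.
(* Connected sets are now cliques, and in a clique with two vertices every vertex is isolated in the
   complement. *)
have sing T t s : T \in bic e -> t \in T -> s \in T -> t = s.
  move=> bT tT sT; apply/eqP; move: bT; apply: contraTT => ts.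
  case: (boolP (conn e T)) => cT; last by rewrite inE (negbTE cT) andbF.
  apply: (@nbic_dominating _ _ t s) => // w wT wt; apply: contraT => ntw.
  have [||p [q [_ _ pX qX pq]]] :=
    conn_cut (X := t |: [set y | e t y]) cT tT wT; rewrite ?inE ?eqxx //.
    by rewrite negb_or wt.
  move: pX qX; rewrite !inE negb_or => /orP[/eqP pt|tp] /andP[qt ntq].
    by rewrite -pt pq in ntq.
  by rewrite (tr _ _ _ tp pq) // eq_sym in ntq.
move: V3 (enum_uniq V); rewrite cardE.
case: (enum V) => [|w1 [|w2 [|w3 [|w4 ws]]]] //= _.
rewrite !inE !negb_or -!andbA => /and5P[w12 w13 w14 _ /and4P[w23 w24 _ /andP[w34 _]]].
(* The competitor has only the edges of a path on four vertices; since [bic e] consists of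
   singletons, it loses nothing and gains that path. *)
pose e' := adde (adde (adde [rel _ _ | false] w1 w2) w2 w3) w3 w4.
have e's : symmetric e' by do 3!apply: adde_sym.
have e'i : irreflexive e' by do 3!apply: adde_irr => //.
have : [set w1; w2; w3; w4] \in bic e.
  apply: (subsetP (bic_max_no_loss m e's e'i _)).
    apply/subsetP => T bT; have /set0Pn[t tT] : T != set0 by move: bT; rewrite inE => /and3P[].
    suff -> : T = [set t] by apply: bic1.
    apply/setP => s; rewrite inE; apply/idP/eqP => [sT|-> //].
    exact: sing bT sT tT.
  have F a b : a != b -> ((a == b) = false) * ((b == a) = false).
    by move=> ab; rewrite [b == a]eq_sym (negbTE ab).
  have {}F := (F _ _ w12, F _ _ w13, F _ _ w14, F _ _ w23, F _ _ w24, F _ _ w34).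
  by apply: bic_path4; rewrite // /e' /adde /= ?eqxx ?F ?orbT.
move/sing => /(_ w1 w2); rewrite !inE !eqxx ?orbT => /(_ isT isT) /eqP.
by rewrite (negbTE w12).
Qed.

Lemma conn_nbr e S y z : conn e S -> y \in S -> z \in S -> y != z ->
  exists2 w, w \in S & e y w.
Proof.
move=> ce yS zS yz.
have [|p [q [_ qS /set1P-> _ yq]]] := conn_cut ce yS zS (set11 y).
  by rewrite inE eq_sym.
by exists q.
Qed.

Lemma bic_max_dist3 e u v : symmetric e -> irreflexive e -> bic_max e ->
  conn e setT ->
  [|| u == v, e u v, [exists a, e u a && e a v] |
      [exists a, exists c, [&& e u a, e a c & e c v]]].
Proof.
move=> es ei m ce; apply: contraT; rewrite !negb_or => /and4P[uv nuv h2 h3].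
have {}h2 a : e u a -> ~~ e a v.
  by move=> ua; apply: contra h2 => av; apply/existsP; exists a; rewrite ua.
have {}h3 a c : e u a -> e a c -> ~~ e c v.
  move=> ua ac; apply: contra h3 => cv.
  by apply/existsP; exists a; apply/existsP; exists c; rewrite ua ac.
have [a _ ua] := conn_nbr ce (in_setT u) (in_setT v) uv.
have vu : v != u by rewrite eq_sym.
have [c _ vc] := conn_nbr ce (in_setT v) (in_setT u) vu.
have au : a != u by apply: contraTneq ua => ->; rewrite ei.
have av : a != v by apply: contraNneq nuv => <-.
have cv : c != v by apply: contraTneq vc => ->; rewrite ei.
have cu : c != u by apply: contraNneq nuv => <-; rewrite es.
have nac : ~~ e a c by apply: contraTN vc => ac; rewrite es; apply: h3 ua ac.
have ncu : ~~ e u c by apply: contraTN vc => uc; rewrite es; apply: h2.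
have : [set a; u; v; c] \in bic e.
  apply: (bic_max_adde es ei m uv) => [T bT uT vT|].
    move: (bT); rewrite inE => /and3P[_ cT _].
    (* An edge of [T] from [p] to [b] leaves the closed neighbourhood of [u]. Then [b] is at
       distance two from [u], so it is not adjacent to [v], and u-b-v is a detour in the
       complement. *)
    have [||p [b [pT bT' pX bX pb]]] :=
      conn_cut (X := u |: [set y | e u y]) cT uT vT.
    - by rewrite !inE eqxx.
    - by rewrite !inE negb_or vu.
    move: bX; rewrite !inE negb_or => /andP[bu nub].
    have up : e u p by move: pX; rewrite !inE => /orP[/eqP pu|//]; rewrite -pu pb in nub.
    have bv : b != v by apply: contraNneq (h2 _ up) => <-.
    have nbv := h3 _ _ up pb.
    apply: (connect_trans (y := b)); apply: restr1 => //; apply: co_adde => //.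
    - by rewrite eq_sym.
    - by rewrite (negbTE bv) andbF.
    - by rewrite (negbTE uv).
    - by rewrite (negbTE bu).
    - by rewrite (negbTE bv).
  apply: bic_path4; rewrite /adde /= ?(es a) ?ua ?vc ?eqxx ?orbT //.
  - exact: adde_sym.
  - exact: adde_irr.
  - by rewrite -es (negbTE (h2 _ ua)) (negbTE au) (negbTE av).
  - by rewrite -es (negbTE nac) (negbTE au) (negbTE av).
  - by rewrite (negbTE ncu) (negbTE cv) (negbTE uv).
apply: contraTT => _; apply: (@nbic_cut _ _ [set a; u] u v);
  rewrite ?inE ?eqxx ?orbT // ?negb_or ?vu ?[v == a]eq_sym ?av //.
move=> p q _ qS /set2P pX; rewrite !inE negb_or => /andP[qa qu].
move: qS; rewrite !inE (negbTE qa) (negbTE qu) /= => /orP[]/eqP->; case: pX => -> //.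
by rewrite es; apply: contraNN nuv => va; have := h2 _ ua; rewrite es va.
Qed.

(** * Blow-ups of the path on four vertices and of the 5-cycle *)

Lemma bic_homog e S X (adjacent : bool) y z : S \in bic e ->
  {in S &, forall p q, p \in X -> q \notin X -> e p q = adjacent} ->
  y \in S -> z \in S -> y \in X -> z \in X.
Proof.
move=> bS h yS zS yX; move: bS; apply: contraTT => zX.
case: adjacent h => h; [apply: (nbic_cocut yS zS yX zX)|apply: (nbic_cut yS zS yX zX)];
  by move=> p q pS qS pX qX; rewrite h.
Qed.

Lemma bic_eq_in e e' S : {in S &, forall y z, e y z = e' y z} ->
  S \in bic e -> S \in bic e'.
Proof.
move=> h; rewrite !inE => /and3P[-> ce cc] /=; apply/andP; split.
  by apply: conn_sub ce => y z yS zS yz; apply: restr1; rewrite // -h.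
by apply: conn_sub cc => y z yS zS yz; apply: restr1; rewrite // /co /= -h.
Qed.

Definition path_adj (i j : nat) := (i.+1 == j) || (j.+1 == i).
Definition cycle5_adj (i j : nat) := (i.+1 %% 5 == j) || (j.+1 %% 5 == i).
Arguments cycle5_adj : simpl never.

(** Vertices of one colour need not be adjacent, so each is linked to a representative of a
    neighbouring colour. Part 0 may be empty, since colours 1, 2, 3, 4 are consecutive on their
    own. *)
Lemma conn_colour5 e S (f : V -> nat) : symmetric e ->
  (forall y, f y < 5) ->
  {in S &, forall y z, (f y).+1 %% 5 = f z -> e y z} ->
  (forall i, 0 < i < 5 -> exists2 t, t \in S & f t = i) -> conn e S.
Proof.
move=> es f5 h reps.
have [t1 t1S f1] := reps 1 isT; have [t2 t2S f2] := reps 2 isT.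
have [t3 t3S f3] := reps 3 isT; have [t4 t4S f4] := reps 4 isT.
have c12 : connect (restr e S) t1 t2 by apply: restr1 => //; apply: h; rewrite ?f1 ?f2.
have c32 : connect (restr e S) t3 t2.
  by apply: restr1 => //; rewrite es; apply: h; rewrite ?f3 ?f2.
apply: (@conn_hub _ _ t2) => // y yS.
move: (f5 y); case fy : (f y) => [|[|[|[|[|k]]]]] // _.
- by apply: connect_trans c12; apply: restr1 => //; apply: h; rewrite ?fy ?f1.
- by apply: restr1 => //; apply: h; rewrite ?fy ?f2.
- apply: connect_trans c12; apply: restr1 => //; rewrite es; apply: h; by rewrite ?fy ?f1.
- by apply: restr1 => //; rewrite es; apply: h; rewrite ?fy ?f2.
- apply: connect_trans c32; apply: restr1 => //; rewrite es; apply: h; by rewrite ?fy ?f3.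
Qed.

(** Reduces facts about residues modulo 5 to a computation over 125 triples. *)
Lemma iota3P (P : nat -> nat -> nat -> bool) :
  all (fun i => all (fun j => all (P i j) (iota 0 5)) (iota 0 5)) (iota 0 5) ->
  forall i j k, i < 5 -> j < 5 -> k < 5 -> P i j k.
Proof.
move=> h i j k i5 j5 k5; have I l : l < 5 -> l \in iota 0 5 by rewrite mem_iota.
by move/allP/(_ i (I _ i5))/allP/(_ j (I _ j5))/allP/(_ k (I _ k5)): h.
Qed.

(** The 5-cycle is isomorphic to its complement, and so is the path that remains when one part is
    empty. Adding [5 - m] gives the possibly empty part [m] the number 0, as [conn_colour5]
    requires. *)
Lemma bic_colour5 e S (f : V -> nat) m : symmetric e -> irreflexive e ->
  (forall y, f y < 5) ->
  (forall y z, f y != f z -> e y z = cycle5_adj (f y) (f z)) ->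
  m < 5 -> (forall i, i < 5 -> i != m -> exists2 t, t \in S & f t = i) ->
  S \in bic e.
Proof.
move=> es ei f5 ef m5 reps; rewrite inE; apply/and3P; split.
- have [i [i5 im]] : exists i, i < 5 /\ i != m by case: m {reps} m5 => [|m]; [exists 1|exists 0].
  by have [t tS _] := reps i i5 im; apply/set0Pn; exists t.
- apply: (@conn_colour5 _ _ (fun y => (f y + (5 - m)) %% 5)) => //.
  + by move=> y; rewrite ltn_mod.
  + move=> y z yS zS /eqP E.
    have := @iota3P (fun m i j => (((i + (5 - m)) %% 5).+1 %% 5 == (j + (5 - m)) %% 5)
      ==> (i != j) && cycle5_adj i j) isT m (f y) (f z) m5 (f5 y) (f5 z).
    by rewrite E => /andP[n c]; rewrite ef.
  + move=> i /andP[i0 i5]; have [||t tS ft] := reps ((i + m) %% 5).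
    * by rewrite ltn_mod.
    * by have := @iota3P (fun m i _ => (0 < i) ==> ((i + m) %% 5 != m)) isT m i 0 m5 i5 isT; rewrite i0.
    * exists t => //; rewrite ft; apply/eqP.
      by exact: (@iota3P (fun m i _ => ((i + m) %% 5 + (5 - m)) %% 5 == i) isT m i 0 m5 i5 isT).
(* Multiplication by 3 turns steps of length 2 into steps of length 1. *)
- apply: (@conn_colour5 _ _ (fun y => (3 * (f y + (5 - m))) %% 5)) => //.
  + exact: co_sym.
  + by move=> y; rewrite ltn_mod.
  + move=> y z yS zS /eqP E.
    have := @iota3P (fun m i j => (((3 * (i + (5 - m))) %% 5).+1 %% 5 == (3 * (j + (5 - m))) %% 5)
      ==> (i != j) && ~~ cycle5_adj i j) isT m (f y) (f z) m5 (f5 y) (f5 z).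
    rewrite E => /andP[n c]; rewrite /co /= ef // c andbT.
    by apply: contraNneq n => ->.
  (* 2 is the inverse of 3 modulo 5: part [2 * i + m] gets the new number [i]. *)
  + move=> i /andP[i0 i5]; have [||t tS ft] := reps ((2 * i + m) %% 5).
    * by rewrite ltn_mod.
    * by have := @iota3P (fun m i _ => (0 < i) ==> ((2 * i + m) %% 5 != m)) isT m i 0 m5 i5 isT; rewrite i0.
    * exists t => //; rewrite ft; apply/eqP.
      by exact: (@iota3P (fun m i _ => (3 * ((2 * i + m) %% 5 + (5 - m))) %% 5 == i) isT m i 0 m5 i5 isT).
Qed.

(** Of any three vertices of the path 0-1-2-3, one is joined to both others or to neither. By
    [bic_homog], a counted set meeting the corresponding part lies inside it; otherwise only two
    parts remain, and the same argument applies to them. *)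
Lemma bic_path4_blowup_mono e (f : V -> nat) S i :
  (forall y, f y < 4) ->
  (forall y z, f y != f z -> e y z = path_adj (f y) (f z)) ->
  S \in bic e -> i < 4 -> {in S, forall p, f p != i} ->
  {in S &, forall p q, f p = f q}.
Proof.
move=> f4 ef bS i4 Si p q pS qS; apply/eqP; apply: contraT => pq.
(* Once part [i] is removed, [k] is the part joined to both or to neither of the two parts listed in
   [others]. *)
pose k := nth 0 [:: 2; 0; 3; 1] i.
pose others := nth [::] [:: [:: 1; 3]; [:: 2; 3]; [:: 0; 1]; [:: 0; 2]] i.
have oth w : w \in S -> f w != k -> f w \in others.
  move=> wS; have := Si w wS; have := f4 w; rewrite /k /others.
  by case: i {Si k others} i4 => [|[|[|[|i]]]] //; case: (f w) => [|[|[|[|j]]]].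
have nok w : w \in S -> f w != k.
  move=> wS; apply: contraNneq pq => fw.
  have H t : t \in S -> t \in [set y | f y == k].
    move=> tS; apply: (@bic_homog _ _ _ (path_adj k (nth 0 others 0)) w t bS) => //; last by rewrite inE fw.
    move=> a b aS bS'; rewrite !inE => /eqP fa fb; have := oth b bS' fb.
    rewrite ef ?fa 1?eq_sym //; rewrite /k /others; case: i {Si k others oth fw fa fb} i4 => [|[|[|[|i]]]] //= _;
    by rewrite !inE => /orP[]/eqP->.
  by have := H p pS; have := H q qS; rewrite !inE => /eqP-> /eqP->.
have in_oth w : w \in S -> f w \in others by move=> wS; apply: oth wS (nok w wS).
have two w : w \in S -> f w != f p -> f w = f q.
  move=> wS; move: (in_oth w wS) (in_oth p pS) (in_oth q qS) pq.
  rewrite /others; case: i {Si k others oth nok in_oth} i4 => [|[|[|[|i]]]] //= _; rewrite !inE => /orP[]/eqP-> /orP[]/eqP-> /orP[]/eqP-> //.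
have : q \in [set y | f y == f p].
  apply: (@bic_homog _ _ _ (path_adj (f p) (f q)) p q bS) => //; last by rewrite inE.
  move=> a b aS bS'; rewrite !inE => /eqP fa fb.
  by rewrite ef ?fa 1?eq_sym // (two b).
by rewrite inE eq_sym (negbTE pq).
Qed.

Section Recolour.
Variables (e : rel V) (f : V -> nat) (a : V).
Hypotheses (es : symmetric e) (ei : irreflexive e) (f4 : forall y, f y < 4).
Hypothesis ef : forall y z, f y != f z -> e y z = path_adj (f y) (f z).

Definition recolour y := if y == a then 4 else f y.

(* The parts 0, 1, 2, 3 of the blown-up path, deprived of a, and the new part
   {a}, numbered 4, form a blow-up of the 5-cycle. *)
Definition reattach : rel V := [rel y z |
  if y == a then (z != a) && cycle5_adj 4 (f z)
  else if z == a then cycle5_adj (f y) 4 else e y z].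

Lemma cycle5_adjC i j : cycle5_adj i j = cycle5_adj j i.
Proof. by rewrite /cycle5_adj orbC. Qed.

Lemma reattach_sym : symmetric reattach.
Proof.
move=> y z; rewrite /reattach /= es.
by case: (eqVneq y a); case: (eqVneq z a) => //= _ _; rewrite cycle5_adjC.
Qed.

Lemma reattach_irr : irreflexive reattach.
Proof. by move=> y; rewrite /reattach /= ei; case: (eqVneq y a). Qed.

Lemma recolour_lt5 y : recolour y < 5.
Proof. by rewrite /recolour; case: ifP => // _; apply/ltnW/f4. Qed.

Lemma reattachE y z : recolour y != recolour z ->
  reattach y z = cycle5_adj (recolour y) (recolour z).
Proof.
rewrite /reattach /recolour /=; case: (eqVneq y a); case: (eqVneq z a) => //= _ _ fyz.
rewrite ef //; move: fyz.
move: (f4 y) (f4 z).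
by case: (f y) => [|[|[|[|i]]]] //; case: (f z) => [|[|[|[|j]]]].
Qed.

Lemma bic_reattach S m : a \in S -> m < 4 ->
  (forall i, i < 4 -> i != m -> exists2 t, t \in S & t != a /\ f t = i) ->
  S \in bic reattach.
Proof.
move=> aS m4 reps; apply: (bic_colour5 reattach_sym reattach_irr recolour_lt5 reattachE (ltnW m4)).
move=> i; rewrite ltnS leq_eqVlt => /orP[/eqP-> _|i4 im].
  by exists a; rewrite // /recolour eqxx.
have [t tS [ta ft]] := reps i i4 im.
by exists t; rewrite // /recolour (negbTE ta).
Qed.

(** Sets avoiding [a] are unaffected. A set meeting all four parts still meets three of them without
    [a], and with [a] as part 4 it remains counted. So a lost set misses a part, and
    [bic_path4_blowup_mono] puts it inside the part of [a]. *)
Lemma reattach_loss S : (forall i, i < 4 -> exists t, f t = i) ->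
  S \in bic e -> S \notin bic reattach ->
  [/\ a \in S, S != [set a] & {in S, forall p, f p = f a}].
Proof.
move=> reps bS nbS; have aS : a \in S.
  apply: contraNT nbS => aS; apply: bic_eq_in bS => y z yS zS.
  rewrite /reattach /=.
  have [ya za] : y != a /\ z != a by split; apply: contraNneq aS => <-.
  by rewrite (negbTE ya) (negbTE za).
split=> //; first by apply: contraNneq nbS => ->; apply: bic1.
have [i i4 Si] : exists2 i, i < 4 & {in S, forall p, f p != i}.
  case: (boolP [exists i : 'I_4, forall p in S, f p != i]).
    by case/existsP=> i /forall_inP h; exists i.
  rewrite negb_exists => /forallP h; case/negP: nbS.
  apply: (@bic_reattach S (f a)) => // i i4 ia.
  have := h (Ordinal i4); rewrite negb_forall_in => /exists_inP[t tS].
  rewrite negbK /= => /eqP ft; exists t => //; split=> //.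
  by apply: contraNneq ia => <-; rewrite ft.
by move=> p pS; apply: (bic_path4_blowup_mono f4 ef bS i4 Si).
Qed.

(** In [e] the enlarged set misses part [m] and meets two parts, hence is not counted. After the
    reattachment [a] fills part 4, and [b], [y], [z] fill the three parts other than [m]. *)
Lemma reattach_gain S b y z m : a \in S -> b \in S -> a != b ->
  {in S, forall p, f p = f a} -> f b = f a -> m < 4 ->
  f y != f a -> f y != m -> f z != m -> f a != m ->
  (forall i, i < 4 -> i \in [:: f a; f y; f z; m]) -> f z != f a ->
  S :|: [set y; z] \in bic reattach :\: bic e.
Proof.
move=> aS bS ab Sa fb m4 ya ym zm am all4 za; rewrite inE; apply/andP; split.
  apply/negP=> bT; have T p : p \in S :|: [set y; z] -> f p != m.
    by rewrite !inE => /orP[/Sa->//|/orP[]/eqP->].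
  have := bic_path4_blowup_mono f4 ef bT m4 T.
  move=> /(_ y a); rewrite !inE eqxx aS ?orbT => /(_ isT isT) /eqP.
  by rewrite (negbTE ya).
apply: (@bic_reattach _ m) => //; first by rewrite inE aS.
move=> i i4 im; have := all4 i i4; rewrite !inE (negbTE im) orbF => /or3P[]/eqP->.
- by exists b; rewrite ?inE ?bS // eq_sym.
- by exists y; rewrite ?inE ?eqxx ?orbT //; split=> //; apply: contraNneq ya => ->.
- by exists z; rewrite ?inE ?eqxx ?orbT //; split=> //; apply: contraNneq za => ->.
Qed.

End Recolour.

(** With more than four vertices, two of them, [a] and [b], share a part; let [y1], [y2], [y3]
    represent the other three. Adding [y1] and [y2] maps the lost sets injectively to gained ones,
    and {a, b, y1, y3} is one more gained set. *)
Lemma path4_blowup_not_bic_max e (f : V -> nat) : symmetric e -> irreflexive e ->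
  4 < #|V| -> (forall y, f y < 4) ->
  (forall i, i < 4 -> exists t, f t = i) ->
  (forall y z, f y != f z -> e y z = path_adj (f y) (f z)) -> ~ bic_max e.
Proof.
move=> es ei V4 f4 reps ef m.
have [a [b [ab fab]]] : exists a b, a != b /\ f a = f b.
  have : ~~ injectiveb (fun y => Ordinal (f4 y)).
    by apply: contraTN V4 => /injectiveP/leq_card; rewrite card_ord -leqNgt.
  by case/injectivePn=> a [b ab [fab]]; exists a, b.
pose k := f a.
have mod4 j : (k + j) %% 4 < 4 by rewrite ltn_mod.
have [y1 f1] := reps _ (mod4 1); have [y2 f2] := reps _ (mod4 2).
have [y3 f3] := reps _ (mod4 3).
pose F := [set S : {set V} | [&& a \in S, S != [set a] & [forall p in S, f p == k]]].
have lossF : bic e :\: bic (reattach e f a) \subset F.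
  apply/subsetP => S /setDP[bS nbS].
  have [aS Sa Sf] := reattach_loss es ei f4 ef reps bS nbS.
  by rewrite inE aS Sa; apply/forall_inP => p /Sf->.
have FP S : S \in F -> [/\ a \in S, exists2 b', b' \in S & a != b' & {in S, forall p, f p = k}].
  rewrite inE => /and3P[aS Sa /forall_inP Sf]; split=> // [|p pS]; last exact/eqP/Sf.
  case: (set_0Vmem (S :\ a)) => [S0|[b' /setD1P[b'a b'S]]]; last by exists b'; rewrite // eq_sym.
  by case/eqP: Sa; rewrite -(setD1K aS) S0 setU0.
pose h (S : {set V}) := S :|: [set y1; y2].
have k4 : k < 4 by apply: f4.
have arith : [&& f y1 != k, f y2 != k, f y3 != k, f y1 != f y2, f y1 != f y3 & f y2 != f y3].
  by rewrite f1 f2 f3; case: (k) k4 => [|[|[|[|]]]].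
case/and5P: arith => n1 n2 n3 n12 /andP[n13 n23].
have all4 i : i < 4 -> (i \in [:: k; f y1; f y2; f y3]) && (i \in [:: k; f y1; f y3; f y2]).
  rewrite f1 f2 f3; by case: (k) k4 => [|[|[|[|]]]] // _; case: i => [|[|[|[|]]]].
have hinj : {in F &, injective h}.
  move=> S T /FP[_ _ Sf] /FP[_ _ Tf] hST; apply/setP => p.
  case: (eqVneq (f p) k) => [fp|fp]; last first.
    by apply/idP/idP => [/Sf|/Tf] fpk; rewrite fpk eqxx in fp.
  have /setP/(_ p) := hST; rewrite !inE.
  have -> : (p == y1) = false by apply: contraNF n1 => /eqP<-; apply/eqP.
  have -> : (p == y2) = false by apply: contraNF n2 => /eqP<-; apply/eqP.
  by rewrite !orbF.
have gain : ([set a; b] :|: [set y1; y3]) |: (h @: F) \subset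
    bic (reattach e f a) :\: bic e.
  rewrite subUset sub1set; apply/andP; split.
    apply: (@reattach_gain _ _ _ es ei f4 ef _ b _ _ (f y2));
      rewrite ?inE ?eqxx ?orbT // 1?eq_sym //.
    - by move=> p /set2P[]->.
    - by move=> i i4; have /andP[] := all4 i i4.
  apply/subsetP => _ /imsetP[S /FP[aS [b' b'S ab'] Sf] ->].
  apply: (@reattach_gain _ _ _ es ei f4 ef _ b' _ _ (f y3)) => //.
  - exact: Sf.
  - by rewrite eq_sym.
  - by move=> i i4; have /andP[] := all4 i i4.
have := leq_trans (subset_leq_card gain) (leq_trans (bic_max_gain_loss m
  (reattach_sym f a es) (reattach_irr f a ei)) (subset_leq_card lossF)).
rewrite cardsU1 (card_in_imset hinj).
suff -> : [set a; b] :|: [set y1; y3] \notin h @: F by rewrite ltnn.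
apply/imsetP => -[S /FP[_ _ Sf] /setP/(_ y3)]; rewrite !inE eqxx !orbT => /esym.
have -> : (y3 \in S) = false by apply: contraNF n3 => /Sf ->.
have -> : (y3 == y1) = false by apply: contraNF n13 => /eqP->.
by have -> : (y3 == y2) = false by apply: contraNF n23 => /eqP->.
Qed.

(** * Structure of a maximizer around a cut vertex *)

Section CutVertex.
Variables (e : rel V) (x : V) (C : {set V}).
Hypotheses (es : symmetric e) (ei : irreflexive e) (em : bic_max e).
Hypotheses (eV : conn e setT) (eC : conn e C) (xC : x \notin C).
Hypothesis sep : forall p q, p \in C -> q \notin C -> q != x -> ~~ e p q.

Lemma sep_facts p q : p \in C -> q \notin C -> q != x ->
  ((p == q) = false) * ((q == p) = false) *
  ((e p q = false) * (e q p = false)).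
Proof.
move=> pC qC qx; rewrite [q == p]eq_sym [e q p]es (negbTE (sep pC qC qx)).
have -> // : (p == q) = false by apply: contraNF qC => /eqP<-.
Qed.

Lemma edge_neq p q : e p q -> ((p == q) = false) * ((q == p) = false).
Proof. by move=> pq; rewrite [q == p]eq_sym; case: eqP pq => // ->; rewrite ei. Qed.

Lemma inside_nbr p q : p \in C -> e p q -> q != x -> q \in C.
Proof. by move=> pC pq qx; apply: contraLR pq => qC; apply: sep. Qed.

Lemma outside_nbr p q : p \notin C -> p != x -> e p q -> q \notin C.
Proof. by move=> pC px pq; apply: contraTN pq => qC; rewrite es; apply: sep. Qed.

Lemma nbr_neq_x p q : ~~ e x p -> e p q -> q != x.
Proof. by move=> xp; apply: contraTneq => ->; rewrite es. Qed.

Lemma mem_cut S p q : S \in bic e -> p \in C -> q \notin C -> p \in S ->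
  q \in S -> x \in S.
Proof.
rewrite inE => /and3P[_ ce _] pC qC pS qS.
have [y [z [_ zS yC zC yz]]] := conn_cut ce pS qS pC qC.
by case: (eqVneq z x) => [<-//|zx]; rewrite (negbTE (sep yC zC zx)) in yz.
Qed.

(** Otherwise the edge uv is added. Within a counted set containing both, [u] has a neighbour [c] in
    [C] and [v] a neighbour [d] outside, so u-d-c-v is a detour in the complement; yet the path
    u'-u-v-v' is created. *)
Lemma outside_complete u v : u \in C -> ~~ e x u -> v \notin C -> v != x ->
  e x v.
Proof.
move=> uC xu vC vx; apply: contraT => xv.
have uvF := sep_facts uC vC vx.
have uv : u != v by rewrite uvF.
have vu : v != u by rewrite uvF.
have [u' _ uu'] := conn_nbr eV (in_setT u) (in_setT v) uv.
have [v' _ vv'] := conn_nbr eV (in_setT v) (in_setT u) vu.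
have u'C := inside_nbr uC uu' (nbr_neq_x xu uu').
have v'C := outside_nbr vC vx vv'; have v'x := nbr_neq_x xv vv'.
have F := (uvF, sep_facts u'C vC vx, sep_facts uC v'C v'x,
  sep_facts u'C v'C v'x, edge_neq uu', edge_neq vv').
have : [set u'; u; v; v'] \in bic e.
  apply: (bic_max_adde es ei em uv) => [T bT uT vT|].
    move: (bT); rewrite inE => /and3P[_ cT _].
    have [c cS uc] := conn_nbr cT uT vT uv.
    have [d dS vd] := conn_nbr cT vT uT vu.
    have cC := inside_nbr uC uc (nbr_neq_x xu uc).
    have dC := outside_nbr vC vx vd; have dx := nbr_neq_x xv vd.
    have G := (uvF, sep_facts cC vC vx, sep_facts uC dC dx,
      sep_facts cC dC dx, edge_neq uc, edge_neq vd).
    apply: (connect_trans (y := d)); last apply: (connect_trans (y := c));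
      by apply: restr1 => //; apply: co_adde; rewrite ?G ?andbF.
  apply: bic_path4; rewrite /adde /= ?(es u') ?F ?uu' ?vv' ?eqxx ?orbT //.
  - exact: adde_sym.
  - exact: adde_irr.
apply: contraTT => _; apply: (@nbic_cut _ _ C u v); rewrite ?inE ?eqxx ?orbT //.
move=> p q _ qS pC qC; apply: sep => //; move: qS qC.
by rewrite !inE -!orbA => /or4P[]/eqP-> //; rewrite ?u'C ?uC.
Qed.

Lemma nbic_outside_pendent S v y : v \notin C -> v != x -> v \in S -> y \in S ->
  y != v -> S \subset v |: C -> S \notin bic e.
Proof.
move=> vC vx vS yS yv /subsetP SC; apply: (nbic_isolated vS yS); first by rewrite eq_sym.
move=> w wS; have := SC w wS; rewrite !inE => /orP[/eqP->|wC]; first by rewrite ei.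
by rewrite es; apply: sep.
Qed.

(** Otherwise the edge vy is added. A counted set containing both contains [x], hence also a
    non-neighbour [w] of [x]; it lies in [C] and is not adjacent to [y], which gives the detour
    v-w-y. An edge from [c] to [d] leaving the closed neighbourhood of [y] yields the new path
    v-y-c-d. *)
Lemma inside_nbr_has_far_nbr y b v : (forall w, w \notin C -> w != x -> e x w) ->
  v \notin C -> v != x ->
  y \in C -> e x y -> b \in C -> ~~ e x b ->
  exists w, [/\ w \in C, ~~ e x w & e y w].
Proof.
move=> Dx vC vx yC xy bC xb.
suff : [exists w, [&& w \in C, ~~ e x w & e y w]].
  by case/existsP=> w /and3P[]; exists w.
apply: contraT; rewrite negb_exists => /forallP nofar.
have {}nofar w : w \in C -> ~~ e x w -> ~~ e y w.
  by move=> wC xw; have := nofar w; rewrite wC xw.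
have [||c [d [cC dC]]] := conn_cut (X := y |: [set w | e y w]) eC yC bC.
- by rewrite !inE eqxx.
- by rewrite !inE negb_or nofar // andbT; apply: contraTneq xy => <-.
rewrite !inE negb_or => cX /andP[dy nyd] cd.
have yc : e y c by case/orP: cX nyd => // /eqP<-; rewrite cd.
have yvF := sep_facts yC vC vx; have vy : v != y by rewrite yvF.
have F := (yvF, sep_facts cC vC vx, sep_facts dC vC vx, edge_neq yc, negbTE dy,
  edge_neq cd).
have : [set v; y; c; d] \in bic e.
  apply: (bic_max_adde es ei em vy) => [T bT vT yT|].
    have xT := mem_cut bT yC vC yT vT.
    move: (bT); rewrite inE => /and3P[_ _ ccT].
    have xy' : x != y by rewrite (edge_neq xy).
    have [w wT /andP[xw nxw]] := conn_nbr ccT xT yT xy'.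
    have wx : w != x by rewrite eq_sym.
    have wC : w \in C by apply: contraNT nxw => wC; apply: Dx.
    have yw : y == w = false by apply: contraNF nxw => /eqP<-.
    have G := (yvF, sep_facts wC vC vx, yw, negbTE (nofar w wC nxw)).
    apply: (connect_trans (y := w)); apply: restr1 => //; apply: co_adde;
     by rewrite ?(es w) ?[w == y]eq_sym ?G ?andbF.
  apply: bic_path4; rewrite /adde /= ?F ?(negbTE nyd) ?yc ?cd ?eqxx ?andbF ?orbT //.
  - exact: adde_sym.
  - exact: adde_irr.
apply: contraTT => _; apply: (@nbic_outside_pendent _ v y);
  rewrite ?inE ?eqxx ?orbT ?yvF //.
by apply/subsetP => w; rewrite !inE -!orbA => /or4P[]/eqP->; rewrite ?eqxx ?yC ?cC ?dC ?orbT.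
Qed.

(* The edge uv is added. A set it destroys is {x, v, u} together with a nonempty
   P included in A, the common neighbours of x and u in C; for every P included
   in A, even empty, it creates {v, u, c, z} together with P, where z' is added
   to record that c is not in P. The alternative z' = z is allowed when c is not
   in A, as c is then never in P. *)
Lemma no_common_nbr_config u v c z z' :
  (forall w, w \notin C -> w != x -> e x w) -> v \notin C -> v != x ->
  u \in C -> ~~ e x u -> c \in C -> e u c ->
  z \in C -> z != u -> ~~ e u z -> e c z ->
  z' \in C -> z' != u -> ~~ e u z' -> (z' == z) && ~~ e x c || e z z' -> False.
Proof.
move=> Dx vC vx uC xu cC uc zC zu uz cz z'C z'u uz' zz'.
have uvF := sep_facts uC vC vx; have uv : u != v by rewrite uvF.
pose A := [set w in C | e x w && e u w].
pose lost (P : {set V}) := [set x; v; u] :|: P.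
pose won (P : {set V}) := [set v; u; c; z] :|: P :|: (if c \in P then set0 else [set z']).
have lostP : bic e :\: bic (adde e u v) \subset lost @: (powerset A :\ set0).
  apply/subsetP => T /setDP[bT nbT].
  have /and3P[uT vT nuv] :
      [&& u \in T, v \in T & ~~ connect (restr (co (adde e u v)) T) u v].
    apply: contraR nbT; rewrite !negb_and negbK => h.
    by apply: bic_adde => // uT vT; move: h; rewrite uT vT.
  have xT := mem_cut bT uC vC uT vT.
  move: (bT); rewrite inE => /and3P[_ cT _].
  have [c0 c0T uc0] := conn_nbr cT uT vT uv.
  have c0C := inside_nbr uC uc0 (nbr_neq_x xu uc0).
  have ux : u == x = false by apply: contraNF xC => /eqP<-.
  (* If one of the next three facts fails, [u] and [v] keep a detour in the new complement:
     u-w-c0-v, u-w-v and u-x-w-v respectively. *)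
  have out w : w \in T -> w \notin C -> w != x -> w = v.
    move=> wT wC wx; apply/eqP; apply: contraNT nuv => wv.
    have F := (uvF, sep_facts c0C vC vx, sep_facts uC wC wx,
      sep_facts c0C wC wx, edge_neq uc0, negbTE wv).
    apply: (connect_trans (y := w)); last apply: (connect_trans (y := c0));
      by apply: restr1 => //; apply: co_adde; rewrite ?F ?andbF.
  have inN w : w \in T -> w \in C -> w != u -> e u w.
    move=> wT wC wu; apply: contraNT nuv => uw.
    have F := (uvF, sep_facts wC vC vx, negbTE wu, negbTE uw).
    apply: (connect_trans (y := w)); apply: restr1 => //; apply: co_adde;
      by rewrite ?[u == w]eq_sym ?F ?andbF.
  have inA w : w \in T -> w \in C -> w != u -> e x w.
    move=> wT wC wu; apply: contraNT nuv => xw.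
    have xw' : x == w = false by apply: contraNF xC => /eqP->.
    have F := (uvF, sep_facts wC vC vx, negbTE wu, negbTE xw, negbTE xu, ux, xw', negbTE vx).
    apply: (connect_trans (y := x)); last apply: (connect_trans (y := w));
      by apply: restr1 => //; apply: co_adde;
      rewrite ?(es u) ?[x == v]eq_sym ?[x == u]eq_sym ?F ?andbF.
  apply/imsetP; exists (T :&: A).
    rewrite !inE subsetIr andbT; apply/set0Pn; exists c0.
    have c0u : c0 != u by rewrite (edge_neq uc0).
    by rewrite !inE c0T c0C uc0 inA.
  apply/setP => w; rewrite !inE -!orbA; apply/idP/idP => [wT|].
    case: (eqVneq w x) => //= wx; case: (eqVneq w v) => //= wv.
    case: (eqVneq w u) => //= wu; rewrite wT /=.
    have wC : w \in C by apply: contraNT wv => wC; rewrite (out w).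
    by rewrite wC inN // inA.
  by case/or4P => [/eqP->|/eqP->|/eqP->|/andP[]].
have zvF := sep_facts zC vC vx; have cvF := sep_facts cC vC vx.
have z'vF := sep_facts z'C vC vx.
have wonP : won @: powerset A \subset bic (adde e u v) :\: bic e.
  apply/subsetP => T0 /imsetP[P]; rewrite powersetE => /subsetP PA {T0}->.
  set T := won P.
  have [vT uT cT zT] : [/\ v \in T, u \in T, c \in T & z \in T].
    by rewrite !inE !eqxx !orbT.
  have TC : T \subset v |: C.
    apply/subsetP=> w; rewrite !inE -!orbA.
    case/or4P => [/eqP->|/eqP->|/eqP->|/or3P[/eqP->|/PA|]];
      rewrite ?eqxx ?uC ?cC ?zC ?orbT //.
      by rewrite inE => /andP[->]; rewrite orbT.
    by case: ifP => _; rewrite !inE // => /eqP->; rewrite z'C orbT.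
  rewrite inE (@nbic_outside_pendent _ v u) //=.
  have as' := adde_sym u v es.
  have hc : connect (restr (adde e u v) T) c u.
    by apply: restr1; rewrite // /adde /= es uc.
  have hz : connect (restr (adde e u v) T) z u.
    by apply: connect_trans hc; apply: restr1; rewrite // /adde /= es cz.
  rewrite inE; apply/and3P; split; first by apply/set0Pn; exists v.
    apply: (@conn_hub _ _ u) => // w wT; move: (wT); rewrite !inE -!orbA.
    case/or4P => [/eqP->|/eqP->|/eqP->|/or3P[/eqP->|/PA|wz']] //.
    - by apply: restr1; rewrite // /adde /= !eqxx !orbT.
    - by rewrite inE => /and3P[_ _ uw]; apply: restr1; rewrite // /adde /= es uw.
    - have {}wz' : w = z' by move: wz'; case: ifP => _; rewrite !inE // => /eqP.
      move: zz'; case: (eqVneq z' z) => [E _|_ /= zz']; first by rewrite wz' E.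
      by apply: connect_trans hz; apply: restr1; rewrite // wz' /adde /= es zz'.
  have cas := co_sym as'.
  (* In the new complement [v] is joined to all other vertices of [T] but [u], which reaches [v]
     through [z]. *)
  apply: (@conn_hub _ _ v) => // w wT.
  have zv : connect (restr (co (adde e u v)) T) z v.
    by apply: restr1 => //; apply: co_adde; rewrite ?zvF ?(negbTE zu) ?andbF.
  case: (eqVneq w v) => [->//|wv].
  case: (eqVneq w u) => [->|wu].
    apply: connect_trans zv; apply: restr1 => //; apply: co_adde;
      by rewrite ?[u == z]eq_sym ?(negbTE uz) ?uvF ?zvF ?(negbTE zu) ?andbF.
  have := subsetP TC w wT; rewrite !inE (negbTE wv) /= => wC.
  have F := (sep_facts wC vC vx, negbTE wu).
  by apply: restr1 => //; apply: co_adde; rewrite ?F ?andbF.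
have wonI : {in powerset A &, injective won}.
  suff sub P Q : P \in powerset A -> Q \in powerset A -> won P = won Q -> P \subset Q.
    by move=> P Q PA QA PQ; apply/eqP; rewrite eqEsubset !sub.
  rewrite !powersetE => /subsetP PA /subsetP QA PQ; apply/subsetP => w wP.
  have := PA w wP; rewrite inE => /and3P[wC xw uw].
  (* A vertex of [P] is adjacent to [u], so it is neither [z] nor [z']; only the membership of [c]
     is ambiguous, and [z'] decides it. *)
  case: (eqVneq w c) => [wc|wc]; last first.
    have : w \in won Q by rewrite -PQ !inE wP !orbT.
    have wu : w == u = false by rewrite (edge_neq uw).
    have wz : w == z = false by apply: contraTF uw => /eqP->.
    have wz' : w == z' = false by apply: contraTF uw => /eqP->.
    rewrite !inE (sep_facts wC vC vx) wu wz (negbTE wc) /= => /orP[//|].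
    by case: ifP => _; rewrite !inE ?wz'.
  rewrite {}wc in wP xw uw *; apply: contraT => cQ.
  have z'z : z' == z = false.
    by apply: contraTF zz' => /eqP->; rewrite eqxx xw ei.
  have : z' \in won P by rewrite PQ !inE (negbTE cQ) !inE eqxx !orbT.
  have z'c : z' == c = false by apply: contraTF uc => /eqP<-.
  rewrite !inE wP inE z'vF (negbTE z'u) z'c z'z orbF /= => /PA.
  by rewrite inE (negbTE uz') !andbF.
(* All subsets of [A] give created sets, but only the nonempty ones can give destroyed sets. *)
have := leq_trans (subset_leq_card wonP) (leq_trans (bic_max_gain_loss em
  (adde_sym u v es) (adde_irr ei uv)) (leq_trans (subset_leq_card lostP) (leq_imset_card _ _))).
rewrite (card_in_imset wonI) [X in X <= _](cardsD1 set0) powersetE sub0set.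
by rewrite add1n ltnn.
Qed.
End CutVertex.

(** [co] is an involution on irreflexive relations, and [bic] treats a relation and its complement
    alike. *)
Lemma bic_max_co e : symmetric e -> irreflexive e -> bic_max e -> bic_max (co e).
Proof.
move=> es ei m e' s i; suff -> : #|bic (co e)| = #|bic e| by apply: m.
have coK : co (co e) =2 e.
  by move=> y z; rewrite /co /=; case: eqP => [->|_] /=; rewrite ?ei ?negbK.
apply: eq_card => S; rewrite !inE; congr (_ && _); rewrite andbC; congr (_ && _).
by apply/idP/idP; apply: conn_sub => y z yS zS yz; apply: restr1; rewrite ?coK // -coK.
Qed.

Lemma bic_max_conn_delete e x : symmetric e -> irreflexive e -> 4 < #|V| ->
  bic_max e -> bic_max (co e) -> conn e [set~ x].
Proof.
move=> es ei V4 m mc; have V3 := ltnW V4.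
have eV := bic_max_conn es ei V3 m.
have ceV := bic_max_conn (co_sym es) (@co_irr e) V3 mc.
apply: contraT => nc.
have [w wx] : exists w, x != w.
  have : 0 < #|[set~ x]| by rewrite cardsC1; case: #|V| V3 => [|[]].
  by rewrite card_gt0 => /set0Pn[w]; rewrite !inE eq_sym; exists w.
(* A non-neighbour of [x] exists since the complement is connected. *)
have [u0 _ /andP[]] := conn_nbr ceV (in_setT x) (in_setT w) wx.
rewrite eq_sym => u0x xu0.
pose C := [set y | (y != x) && connect (restr e [set~ x]) u0 y].
have u0C : u0 \in C by rewrite inE u0x connect0.
have xC : x \notin C by rewrite inE eqxx.
have [v0 v0C v0x] : exists2 v0, v0 \notin C & v0 != x.
  apply/exists_inP; move: nc; apply: contraR; rewrite negb_exists => /forallP h.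
  apply: (@conn_hub _ _ u0) => // y; rewrite !inE => yx.
  by have := h y; rewrite inE yx /= andbT negbK connectC.
have sep p q : p \in C -> q \notin C -> q != x -> ~~ e p q.
  rewrite !inE => /andP[px cp] + qx; rewrite qx /=; apply: contra => pq.
  by apply: connect_trans cp _; apply: restr1; rewrite ?inE.
have eC : conn e C.
  apply: (@conn_hub _ _ u0) => // y yC; rewrite connectC //.
  apply: contraT => nuy; have := yC; rewrite inE => /andP[yx cy].
  have [||p [q []]] := @connect_cut _ [set t | connect (restr e C) u0 t && (t \in C)] _ _ cy.
  - by rewrite inE u0C connect0.
  - by rewrite inE (negbTE nuy).
  rewrite !inE => /andP[cp /andP[px cp']] nq /and3P[_ qx pq].
  have pC : p \in C by rewrite inE px.
  have qC : q \in C by apply: contraLR pq => qC; apply: sep; rewrite // -in_setC1.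
  case/negP: nq; move: (qC); rewrite inE => ->; rewrite andbT.
  exact: connect_trans cp (restr1 pC qC pq).
have Dx v : v \notin C -> v != x -> e x v.
  exact: (outside_complete es ei m eV sep u0C xu0).
have far := inside_nbr_has_far_nbr es ei m eC sep.
have step := no_common_nbr_config es ei m xC sep Dx v0C v0x.
have AB u z : u \in C -> ~~ e x u -> z \in C -> e x z -> e u z.
  move=> uC xu zC xz; apply: contraT => uz.
  have zu : z != u by apply: contraTneq xz => ->.
  have [u1 [u1C xu1 zu1]] := far z u0 v0 Dx v0C v0x zC xz u0C xu0.
  case: (boolP (e u u1)) => uu1.
    case: (step u u1 z z) => //; first by rewrite es.
    by rewrite eqxx xu1.
  have u1u : u1 != u by apply: contraTneq zu1 => ->; rewrite es.
  (* [Z] collects the non-isolated vertices of the graph induced on the non-neighbours of [u] in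
     [C], other than [u]. It contains [z]. If an edge leads from [p] in [Z] to [q] in [C] outside
     [Z], then [q] is a neighbour of [u], because otherwise [p] would put [q] into [Z]. *)
  pose Z := [set y in C | [&& y != u, ~~ e u y &
    [exists y', [&& y' \in C, y' != u, ~~ e u y' & e y y']]]].
  have [||p [q [pC qC]]] := conn_cut (X := Z) eC zC uC.
  - rewrite inE zC zu uz; apply/existsP; exists u1.
    by rewrite u1C u1u uu1.
  - by rewrite inE eqxx /= andbF.
  rewrite inE => /and4P[_ pu up /existsP[z' /and4P[z'C z'u uz' pz']]] qZ pq.
  have uq : e u q.
    apply: contraNT qZ => uq; rewrite inE qC uq /=; apply/andP; split.
      by apply: contraTneq pq => ->; rewrite es.
    by apply/existsP; exists p; rewrite pC pu up es.
  case: (step u q p z') => //; first by rewrite es.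
  by rewrite pz' orbT.
have [p [q [_ _ pC qC pq]]] := conn_cut eV (in_setT u0) (in_setT x) u0C xC.
have qx : q = x by apply/eqP; apply: contraTT pq => qx; apply: sep.
(* Parts 0, 1, 2, 3 are D, {x}, A, B; part 2 is nonempty because [p] is a neighbour of [x] in
   [C]. *)
pose f y := if y == x then 1 else if y \notin C then 0 else if e x y then 2 else 3.
case: (@path4_blowup_not_bic_max e f es ei V4) => //.
- by move=> y; rewrite /f; do !case: ifP.
- case=> [|[|[|[|//]]]] _.
  + by exists v0; rewrite /f (negbTE v0x) v0C.
  + by exists x; rewrite /f eqxx.
  + exists p; rewrite /f pC; rewrite qx es in pq; rewrite pq.
    by case: eqP pC xC => // -> ->.
  + by exists u0; rewrite /f u0C (negbTE u0x) (negbTE xu0).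
- have Dx' v : v != x -> v \notin C -> e x v by move=> *; apply: Dx.
  have F y : f y = if y == x then 1 else if y \notin C then 0 else if e x y then 2 else 3 by [].
  move=> y z; rewrite !F.
  case: (eqVneq y x) => [->|yx]; case: (eqVneq z x) => [->|zx] //=.
  + case: ifP => [zC _|zC]; first by rewrite Dx.
    by case: ifP.
  + case: ifP => [yC _|yC]; first by rewrite es Dx.
    by rewrite es; case: ifP.
  + case: (boolP (y \in C)) => yC; case: (boolP (z \in C)) => zC //=.
    * case: (boolP (e x y)) => xy; case: (boolP (e x z)) => xz //= _.
        by rewrite es AB.
      by rewrite AB.
    * by rewrite (negbTE (sep _ _ yC zC zx)); case: ifP.
    * by rewrite (es y) (negbTE (sep _ _ zC yC yx)); case: ifP.
Qed.
End Relations.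

(** * Translation to graphs: distances, degrees and components *)

Section Graphs.
Variable G : graph.
Implicit Types (S : {set G}) (x y : G).
Local Notation e := (@adj G).
Let es : symmetric e := @adj_sym G.
Let ei : irreflexive e := @adj_irr G.

Lemma connected_induced S : connected (induced S) = conn e S.
Proof.
apply/forallP/connP => [h y z yS zS | h u].
  suff walk u w : connect (@adj (induced S)) u w -> connect (restr e S) (val u) (val w).
    exact: walk (exist _ y yS) (exist _ z zS) (forallP (h _) _).
  case/connectP=> p + ->; elim: p u => [|t p IH] u /=; first by rewrite connect0.
  by case/andP=> ut /IH; apply: connect_trans; apply: restr1; rewrite ?(valP u) ?(valP t).
apply/forallP => w; case/connectP: (h _ _ (valP u) (valP w)) => p.
elim: p u => [|y p IH] u /=; first by move=> _ /val_inj->; apply: connect0.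
case/andP=> /and3P[_ yS uy] pp Ew.
apply: connect_trans (IH (exist _ y yS) pp Ew).
exact: connect1.
Qed.

Lemma connected_conn : connected G = conn e setT.
Proof.
have E : connect e =2 connect (restr e setT).
  by apply: eq_connect => y z; rewrite /restr /= !inE.
apply/idP/idP => [/forallP h|/connP h].
  by apply/connP => y z _ _; rewrite -E; apply: (forallP (h y)).
by apply/forallP => y; apply/forallP => z; rewrite E; apply: h; rewrite inE.
Qed.

Lemma num_components_connected x : connected G -> num_components G = 1.
Proof.
move=> /forallP c; rewrite -(n_comp_connect (sym_connect_sym es) x).
apply: eq_n_comp_r => y; rewrite !inE; apply/esym; exact: (forallP (c x)).
Qed.

Lemma dist_le k x y : k < #|G| -> has_walk x y k -> dist x y <= k.
Proof.
move=> kG w; rewrite leqNgt; apply/negP => /(before_find 0).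
by rewrite nth_iota // add0n w.
Qed.

Lemma diameter23 : 3 < #|G| ->
  (forall u v : G, [|| u == v, e u v, [exists a, e u a && e a v] |
      [exists a, exists c, [&& e u a, e a c & e c v]]]) ->
  (exists u v, co e u v) -> diameter G = 2 \/ diameter G = 3.
Proof.
move=> G3 h [u [v /andP[uv nuv]]].
suff : 2 <= diameter G <= 3.
  by case: (diameter G) => [|[|[|[|d]]]] // _; [left|right].
apply/andP; split; last first.
  apply/bigmax_leqP => y _; apply/bigmax_leqP => z _.
  (* The bound on the order keeps lengths up to 3 in the search range of [dist]. *)
  have walk k : k <= 3 -> has_walk y z k -> dist y z <= 3.
    by move=> k3 w; apply: leq_trans (k3); apply: dist_le w; apply: leq_ltn_trans G3.
  case/or4P: (h y z) => [/eqP yz|yz|/existsP[a /andP[ya az]]|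
      /existsP[a /existsP[c /and3P[ya ac cz]]]].
  - by apply: (walk 0) => //; apply/existsP; exists [tuple]; rewrite /= yz.
  - by apply: (walk 1) => //; apply/existsP; exists [tuple z]; rewrite /= yz eqxx.
  - by apply: (walk 2) => //; apply/existsP; exists [tuple a; z]; rewrite /= ya az eqxx.
  - by apply: (walk 3) => //; apply/existsP; exists [tuple a; c; z]; rewrite /= ya ac cz eqxx.
apply: leq_trans (leq_bigmax u); apply: leq_trans (leq_bigmax v).
rewrite leqNgt; apply/negP => d2.
(* A distance below [#|G|] means that [find] succeeded, so a walk of length 0 or 1 exists. *)
have dG : dist u v < #|G| by apply: leq_trans d2 (ltnW (ltnW G3)).
have : has_walk u v (nth 0 (iota 0 #|G|) (dist u v)).
  by apply: nth_find; rewrite has_find size_iota.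
rewrite nth_iota // add0n; case: (dist u v) d2 => [|[|//]] _ /existsP[p].
  by rewrite tuple0 /= (negbTE uv).
case/tupleP: p => w p; rewrite tuple0 /= andbT => /andP[uw /eqP wv].
by rewrite -wv uw in nuv.
Qed.

(** Without its only neighbour [y], the vertex [x] would be isolated, while a third vertex [z]
    remains. *)
Lemma conn_delete_not_pendent x : 2 < #|G| ->
  (forall y, conn e [set~ y]) -> ~~ pendent x.
Proof.
move=> G2 h; apply/negP => /cards1P[y /setP xy].
have xy' : e x y by have := xy y; rewrite !inE eqxx.
have xney : x != y by apply: contraTneq xy' => ->; rewrite ei.
have [z] : exists z, z \in ~: [set x; y].
  by apply/set0Pn; rewrite -card_gt0 cardsCs setCK cards2 xney subn_gt0.
rewrite !inE negb_or => /andP[zx zy].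
have [|||w] := @conn_nbr _ e [set~ y] x z (h y); rewrite ?inE // 1?eq_sym //.
by move=> wy xw; have := xy w; rewrite !inE xw eq_sym (negbTE wy).
Qed.

End Graphs.

(** [G] minus [x] is nonempty and has one component, while [G] has at least the component of [x]. *)
Lemma conn_delete_not_cut_vertex (G : graph) (x : G) : 1 < #|G| ->
  conn (@adj G) [set~ x] -> ~~ cut_vertex x.
Proof.
move=> G1 h; rewrite /cut_vertex -leqNgt.
have [y] : exists y, y \in [set~ x].
  by apply/set0Pn; rewrite -card_gt0 cardsC1; case: #|G| G1 => [|[]].
move=> yx; rewrite (num_components_connected (exist _ y yx : induced [set~ x])).
  rewrite /num_components -(n_comp_connect (sym_connect_sym (@adj_sym G)) x).
  by apply: subset_leq_card; apply/subsetP => z; rewrite !inE => /andP[-> _].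
by rewrite connected_induced.
Qed.

(** Inclusion-exclusion: by [conn_or] the union of the two families consists of all nonempty sets,
    and their intersection is [bic]. *)
Lemma eta_sum (G : graph) : eta G + eta (complement G) =
  #|[set S : {set G} | S != set0]| + #|bic (@adj G)|.
Proof.
rewrite -cardsUI; congr (_ + _); apply: eq_card => S; rewrite !inE.
  rewrite -andb_orr (connected_induced S) (connected_induced (G := complement G) S).
  by rewrite (conn_or S (@adj_sym G)) andbT.
rewrite (connected_induced S) (connected_induced (G := complement G) S).
by rewrite andbACA andbb.
Qed.

Lemma bic_max_graph_properties (G : graph) : 4 < #|G| ->
  bic_max (@adj G) -> bic_max (co (@adj G)) ->
  [/\ connected G, diameter G = 2 \/ diameter G = 3 &
      forall x : G, ~~ pendent x /\ ~~ cut_vertex x].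
Proof.
move=> G4 m mc; have es := @adj_sym G; have ei := @adj_irr G.
have G3 := ltnW G4; have G2 := ltnW G3.
have c := bic_max_conn es ei G3 m.
have del x := bic_max_conn_delete x es ei G4 m mc.
split; first by rewrite connected_conn.
  apply: diameter23 => // [u v|]; first exact: bic_max_dist3.
  have /card_gt1P[u [v [_ _ uv]]] := ltnW G2.
  have cc := bic_max_conn (co_sym es) (@co_irr _ _) G3 mc.
  by have [w _ uw] := conn_nbr cc (in_setT u) (in_setT v) uv; exists u, w.
move=> x; split; first exact: conn_delete_not_pendent.
exact: conn_delete_not_cut_vertex (ltnW G2) (del x).
Qed.

Theorem theorem3 (n : nat) (G : graph) (n_gt4 : 4 < n) (cardG : #|G| = n)
    (maxG : forall H : graph, #|H| = n ->
       eta H + eta (complement H) <= eta G + eta (complement G)) :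
  [/\ connected G /\ connected (complement G),
      (diameter G = 2 \/ diameter G = 3) /\
      (diameter (complement G) = 2 \/ diameter (complement G) = 3) &
      (forall x : G, ~~ pendent x /\ ~~ cut_vertex x) /\
      (forall x : complement G, ~~ pendent x /\ ~~ cut_vertex x)].
Proof.
have es := @adj_sym G; have ei := @adj_irr G.
have m : bic_max (@adj G).
  move=> e' s i; have := maxG (Graph s i) cardG.
  by rewrite !eta_sum leq_add2l.
have mc := bic_max_co es ei m.
have mcc := bic_max_co (co_sym es) (@co_irr _ _) mc.
rewrite -cardG in n_gt4.
have [c1 d1 p1] := bic_max_graph_properties n_gt4 m mc.
have [c2 d2 p2] := @bic_max_graph_properties (complement G) n_gt4 mc mcc.
by [].
Qed.
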